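(* A position $(a,b)$ with $a\le b$ has Sprague-Grundy value $1$ in mis\`ere $\mathcal{F}$-Wythoff if and only if it is an element of the set $$\{(0,0)\}\cup\{(\lfloor \phi n \rfloor+1,\ \lfloor \phi^2 n \rfloor +1) \mid n \in \mathbb{Z},\ n\geq 0 \}.$$
   Context: $\phi = (1+\sqrt5)/2$ and $\lfloor\cdot\rfloor$ is the integer part. A position is an unordered pair $(a,b)$ of nonnegative integers (two piles of tokens); $(a,b)$ is identified with $(b,a)$. $\mathcal{F}$-Wythoff is the impartial game with the following legal moves: (i) remove any positive number of tokens from one pile; (ii) remove the same positive number $k$ of tokens from both piles, provided the integer ratio of the two entries does not change, i.e. from $(a,b)$ with $1\le a\le b$ one may move to $(a-k,b-k)$ with $1\le k<a$ if $\lfloor (b-k)/(a-k)\rfloor=\lfloor b/a\rfloor$. The followers of $p$ are the positions reachable from $p$ by one legal move. For a finite set $S$ of nonnegative integers, $\mathrm{mex}(S)$ is the smallest nonnegative integer not in $S$. The mis\`ere version (the player making the last move loses) is modelled by adding to the game graph one extra sink vertex and an edge from the terminal position $(0,0)$ to it. The Sprague-Grundy function $\mathcal{G}^-$ of mis\`ere $\mathcal{F}$-Wythoff is the usual mex-recursive function on this enlarged graph: the extra sink has value $0$, hence $\mathcal{G}^-(0,0)=1$, and for every other position $p$, $\mathcal{G}^-(p)=\mathrm{mex}\{\mathcal{G}^-(q)\mid q\text{ is a follower of }p\}$. *)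

(* Defs.v *)
From HB Require Import structures.
From mathcomp Require Import all_boot all_order all_algebra.
From mathcomp Require Import classical_sets reals.
Set Implicit Arguments.
Unset Strict Implicit.
Unset Printing Implicit Defensive.
Import Order.TTheory GRing.Theory Num.Theory.

Lemma mex_exists (s : seq nat) : exists n, n \notin s.
Proof.
exists (\max_(i <- s) i).+1; apply/negP => sin.
by have := @leq_bigmax_seq _ s xpredT id _ sin isT; rewrite ltnn.
Qed.

Definition mex (s : seq nat) : nat := ex_minn (mex_exists s).

(* An unordered pair of nonnegative integers is represented by its sorted
   version, so that [upos a b] and [upos b a] are the same position. *)
Definition position : Type := {p : nat * nat | p.1 <= p.2}.

Fact upos_subproof (a b : nat) : minn a b <= maxn a b.
Proof. by rewrite (leq_trans (geq_minl a b)) ?leq_maxl. Qed.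

Definition upos (a b : nat) : position :=
  exist (fun p : nat * nat => p.1 <= p.2) (minn a b, maxn a b)
        (upos_subproof a b).

Lemma uposC (a b : nat) : upos a b = upos b a.
Proof. by apply: val_inj; rewrite /= minnC maxnC. Qed.

Lemma uposE (p : position) : upos (val p).1 (val p).2 = p.
Proof.
case: p => [[a b] /= ab]; apply: val_inj => /=.
by rewrite (minn_idPl ab) (maxn_idPr ab).
Qed.

(* Removing tokens from either pile is covered by [move_one], since
   [upos a b] and [upos b a] are equal. *)
Inductive move : position -> position -> Prop :=
| move_one (a b k : nat) of 1 <= k <= a :
    move (upos a b) (upos (a - k) b)
| move_both (a b k : nat) of 1 <= a <= b & 1 <= k < a
    & (b - k) %/ (a - k) = b %/ a :
    move (upos a b) (upos (a - k) (b - k)).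

Definition followers (p : position) : seq position :=
  let: (a, b) := val p in
  [seq upos (a - k) b | k <- iota 1 a] ++
  [seq upos a (b - k) | k <- iota 1 b] ++
  [seq upos (a - k) (b - k)
    | k <- iota 1 a.-1 & (b - k) %/ (a - k) == b %/ a].

Lemma followersP (p q : position) : reflect (move p q) (q \in followers p).
Proof.
apply: (iffP idP).
  rewrite -{2}[p]uposE /followers; case: p => [[a b] /= ab].
  rewrite !mem_cat => /or3P[] /mapP[k].
  - rewrite mem_iota add1n ltnS => hk ->; exact: move_one.
  - rewrite mem_iota add1n ltnS => hk ->.
    by rewrite uposC [upos a (b - k)]uposC; apply: move_one.
  rewrite mem_filter mem_iota => /andP[/eqP e /andP[k0 ka]] ->.
  have {}ka : k < a by case: (a) ka k0 => [|a'] //=; case: k {e}.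
  by apply: move_both; rewrite ?k0 // ab (leq_ltn_trans _ ka).
case=> [a b k hk|a b k /andP[a0 ab] /andP[k0 ka] e].
  rewrite /followers /= !mem_cat; case: (leqP a b) => ab.
    by apply/orP; left; apply: map_f; rewrite mem_iota add1n ltnS.
  apply/orP; right; apply/orP; left; rewrite uposC.
  by apply: map_f; rewrite mem_iota add1n ltnS.
rewrite /followers /= (minn_idPl ab) (maxn_idPr ab) !mem_cat.
apply/orP; right; apply/orP; right; apply: map_f.
by rewrite mem_filter e eqxx mem_iota k0 add1n prednK.
Qed.

(* Vertices of the game graph of the misere version: [Some p] is the
   position [p] and [None] is the extra sink. *)
Definition vertex : Type := option position.

Definition misere_followers (v : vertex) : seq vertex :=
  if v is Some p then
    (if p == upos 0 0 then [:: None] else map some (followers p))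
  else [::].

Definition rank (v : vertex) : nat :=
  if v is Some p then ((val p).1 + (val p).2).+1 else 0.

Lemma rank_misere_followers (v w : vertex) :
  w \in misere_followers v -> rank w < rank v.
Proof.
case: v => [p|] //=; case: ifP => _; first by rewrite inE => /eqP ->.
case/mapP => q /followersP + -> /=; rewrite ltnS.
have sE a b : minn a b + maxn a b = a + b by rewrite addn_min_max.
case=> [a b k /andP[k0 ka]|a b k /andP[a0 ab] /andP[k0 ka] _] /=; rewrite !sE.
  by rewrite ltn_add2r ltn_subrL k0 (leq_trans k0 ka).
by rewrite -addSn leq_add ?leq_subr // ltn_subrL k0 a0.
Qed.

(* [n] is only a bound on the recursion depth; [grundyE] is the defining
   equation of the Sprague-Grundy function. *)
Fixpoint grundy_rec (n : nat) (v : vertex) : nat :=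
  if n is n'.+1 then mex [seq grundy_rec n' w | w <- misere_followers v]
  else 0.

Definition grundy (v : vertex) : nat := grundy_rec (rank v).+1 v.

Lemma grundyE (v : vertex) :
  grundy v = mex [seq grundy w | w <- misere_followers v].
Proof.
have stable n m u : rank u < n -> rank u < m ->
    grundy_rec n u = grundy_rec m u.
  elim: n m u => [|n IHn] [|m] u //= un um; congr mex.
  apply/eq_in_map => w /rank_misere_followers wu.
  by apply: IHn; apply: leq_trans wu _.
rewrite {1}/grundy /=; congr mex; apply/eq_in_map => w wv.
by apply: stable => //; apply: rank_misere_followers.
Qed.

Definition misere_grundy (p : position) : nat := grundy (Some p).

Lemma grundy_sink : grundy None = 0.
Proof. by rewrite grundyE /mex; case: ex_minnP => -[|m] //= _ /(_ 0 isT). Qed.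

Lemma misere_grundy_upos00 : misere_grundy (upos 0 0) = 1.
Proof.
rewrite /misere_grundy grundyE /misere_followers eqxx /= grundy_sink /mex.
by case: ex_minnP => -[|[|m]] //= _ /(_ 1 isT).
Qed.

Lemma misere_grundyE (p : position) : p != upos 0 0 ->
  misere_grundy p = mex [seq misere_grundy q | q <- followers p].
Proof.
by move=> p0; rewrite {1}/misere_grundy grundyE /misere_followers (negPf p0) -map_comp.
Qed.

Local Open Scope ring_scope.
Local Open Scope classical_set_scope.

Definition phi (R : realType) : R := (1 + Num.sqrt 5) / 2.

Definition wythoff_shift (R : realType) : set (nat * nat) :=
  [set (0%N, 0%N)] `|`
  [set p | exists n : int,
    [/\ 0 <= n, p.1%:Z = Num.floor (phi R * n%:~R) + 1
      & p.2%:Z = Num.floor (phi R ^+ 2 * n%:~R) + 1]].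

(* Main.v *)
(* For c = 1, 2 let K_c consist of the positions (A_n + c, B_n + c), where
   A_n = floor (phi n) and B_n = A_n + n, together with (0, c - 1).  By Beatty's
   theorem every integer >= c occurs once in the rows and columns of K_c (c
   itself twice, in (c, c)), and every difference occurs once among the
   (A_n + c, B_n + c).  Hence no move joins two elements of K_c, and every
   nonterminal position outside K_c has a move into K_c; the ratio condition is
   harmless there, because both ratios are 1.  So K_2 is the set of misere value
   0.  The elements of K_1 other than (0, 0) lie outside K_2, so they have a move
   into K_2 and none into K_1, whence K_1 is the set of misere value 1. *)

Require Import Defs.
From mathcomp Require Import all_boot all_order all_algebra.
From mathcomp Require Import classical_sets reals.
From mathcomp Require Import zify lra.
Set Implicit Arguments.
Unset Strict Implicit.
Unset Printing Implicit Defensive.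
Import Order.TTheory GRing.Theory Num.Theory.

(** * Irrationality of the golden ratio and Beatty's theorem *)

Lemma golden_nat_eq0 (x n : nat) : x * x = x * n + n * n -> n = 0.
Proof.
elim/ltn_ind: n x => n IHn x xn; have [//|n0] := posnP n.
have nx : n < x by nia.
have xn2 : x < n + n by nia.
(* Infinite descent: the pair ([n], [x - n]) satisfies the same equation, and [x - n < n]. *)
have := IHn (x - n) ltac:(lia) n; nia.
Qed.

Section GoldenBeatty.
Local Open Scope ring_scope.

Lemma phi_sqr (R : realType) : phi R ^+ 2 = phi R + 1.
Proof.
have s5 : Num.sqrt (5 : R) ^+ 2 = 5 by rewrite sqr_sqrtr.
rewrite /phi; set s := Num.sqrt _ in s5 *; lra.
Qed.

Lemma phi_gt1 (R : realType) : 1 < phi R.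
Proof.
have : Num.sqrt (1 : R) < Num.sqrt 5 by rewrite ltr_sqrt; lra.
rewrite sqrtr1 /phi; lra.
Qed.

Lemma phi_irrational (R : realType) (x n : nat) :
  phi R * n%:R = x%:R -> n = 0%N.
Proof.
move=> e; apply: (@golden_nat_eq0 x); apply/eqP.
rewrite -(eqr_nat R) natrD !natrM -e; apply/eqP.
have := phi_sqr R; move: (phi R) (n%:R) => f y; nra.
Qed.

Definition lower_wythoff (R : realType) (n : nat) : nat :=
  Num.truncn (phi R * n%:R).

Lemma phi_nat_ge0 (R : realType) (n : nat) : 0 <= phi R * n%:R.
Proof. by rewrite mulr_ge0 // ltW // (lt_trans ltr01) // phi_gt1. Qed.

Lemma lower_wythoff_itv (R : realType) (n : nat) :
  (lower_wythoff R n)%:R <= phi R * n%:R < (lower_wythoff R n).+1%:R.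
Proof. exact: truncn_itv (phi_nat_ge0 R n). Qed.

Lemma lower_wythoff_eq (R : realType) (n x : nat) :
  x%:R <= phi R * n%:R < x.+1%:R -> lower_wythoff R n = x.
Proof. exact: truncn_def. Qed.

Lemma lower_wythoff0 (R : realType) : lower_wythoff R 0 = 0%N.
Proof. by rewrite /lower_wythoff mulr0 truncn0. Qed.

Lemma leq_lower_wythoff (R : realType) (n : nat) : (n <= lower_wythoff R n)%N.
Proof.
rewrite /lower_wythoff truncn_ge_nat ?phi_nat_ge0 //.
by rewrite ler_peMl // ltW // phi_gt1.
Qed.

Lemma lower_wythoffS (R : realType) (n : nat) :
  (lower_wythoff R n < lower_wythoff R n.+1)%N.
Proof.
rewrite /lower_wythoff truncn_ge_nat ?phi_nat_ge0 //.
have /andP[+ _] := lower_wythoff_itv R n; have := phi_gt1 R.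
rewrite /lower_wythoff -[n.+1]addn1 -[(Num.truncn _).+1]addn1 !natrD; lra.
Qed.

Lemma ltn_lower_wythoff (R : realType) :
  {mono lower_wythoff R : m n / (m < n)%N}.
Proof.
apply: leqW_mono; apply: leq_mono; apply: homo_ltn => [y x z|n].
  exact: ltn_trans.
exact: lower_wythoffS.
Qed.

(* Since [phi * (phi - 1) = 1], the bounds [j < phi m < j + 1] are equivalent
   to [phi j < j + m] and [j + m + 1 < phi (j + 1)]: an upper term [j + m] is
   exactly an integer skipped by the multiples of [phi]. *)
Lemma upper_wythoff_gap (R : realType) (j m : nat) :
  (j%:R < phi R * m%:R < j.+1%:R) =
  (phi R * j%:R < (j + m)%:R) && ((j + m).+1%:R < phi R * j.+1%:R).
Proof.
have f1 := phi_gt1 R; have f2 := phi_sqr R.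
rewrite -[j.+1]addn1 -[(j + m).+1]addn1 !natrD.
move: (phi R) f1 f2 (j%:R) (m%:R) => f f1 f2 x y.
have ff : f * (f - 1) = 1 by lra.
have f0 : 0 < f - 1 by lra.
have fy : f * y * (f - 1) = y by rewrite mulrAC ff mul1r.
congr andb; first by rewrite -[LHS](ltr_pM2r f0) fy; apply/idP/idP; lra.
by rewrite -[LHS](ltr_pM2r f0) fy; apply/idP/idP; lra.
Qed.

(** Let [j] be maximal with [phi j <= x]. If [phi (j + 1) < x + 1] or [phi j = x], then [x] is a
    lower term. Otherwise irrationality makes both gap inequalities strict, and [x] is the upper
    term of index [x - j]. *)
Lemma wythoff_cover (R : realType) (x : nat) :
  exists n, x = lower_wythoff R n \/ x = (lower_wythoff R n + n)%N.
Proof.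
have ex0 : exists k : nat, phi R * k%:R <= x%:R by exists 0%N; rewrite mulr0.
have bx (k : nat) : phi R * k%:R <= x%:R -> (k <= x)%N.
  move=> kx; rewrite -(ler_nat R); apply: le_trans kx.
  by rewrite ler_peMl // ltW // phi_gt1.
case: (ex_maxnP ex0 bx) => j jx jmax.
have xj : x%:R < phi R * j.+1%:R.
  by rewrite ltNge; apply/negP => /jmax; rewrite ltnn.
have [xj1|] := ltP (phi R * j.+1%:R) x.+1%:R.
  by exists j.+1; left; apply/esym/lower_wythoff_eq; rewrite xj1 ltW.
rewrite le_eqVlt => /predU1P[/esym/phi_irrational //|xj1].
move: jx; rewrite le_eqVlt => /predU1P[ejx|jx].
  exists j; left; apply/esym/lower_wythoff_eq.
  by rewrite ejx lexx ltr_nat ltnSn.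
have jlex : (j <= x)%N by apply/bx/ltW.
exists (x - j)%N; right; rewrite (@lower_wythoff_eq R _ j) ?subnKC //.
have := upper_wythoff_gap R j (x - j); rewrite subnKC // jx xj1.
by case/andP => /ltW -> ->.
Qed.

(** For [m > 0] the gap inequalities would squeeze [phi n] strictly between [phi j] and
    [phi (j + 1)]. The sequences do meet at 0, hence the form of the conclusion. *)
Lemma lower_wythoff_neq_upper (R : realType) (m n : nat) :
  lower_wythoff R n = (lower_wythoff R m + m)%N -> m = 0%N.
Proof.
have /andP[] := lower_wythoff_itv R m.
set j := lower_wythoff R m; rewrite le_eqVlt.
move=> /predU1P[/esym/phi_irrational //|jm mj].
move=> e; have := upper_wythoff_gap R j m.
rewrite jm mj /= => /esym/andP[h1 h2].
have := lower_wythoff_itv R n; rewrite e => /andP[h3 h4].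
have f0 : 0 < phi R by rewrite (lt_trans ltr01) // phi_gt1.
have := lt_le_trans h1 h3; have := lt_trans h4 h2.
rewrite !ltr_pM2l // !ltr_nat; lia.
Qed.

End GoldenBeatty.

(** * The sets K_c as kernels of the game graph *)

Definition shifted_wythoff (R : realType) (c : nat) (p : position) : Prop :=
  exists n, p = upos (lower_wythoff R n + c) (lower_wythoff R n + n + c).

(** Shifted pairs have entries at least [c]; the extra position serves the rows below: row 0 for
    [c = 1], rows 0 and 1 for [c = 2]. *)
Definition kernel (R : realType) (c : nat) (p : position) : Prop :=
  p = upos 0 c.-1 \/ shifted_wythoff R c p.

Lemma upos_eq (a b c d : nat) :
  upos a b = upos c d <-> (a = c /\ b = d) \/ (a = d /\ b = c).
Proof.
split=> [[]|[[-> ->]|[-> ->]]]; [lia|by []|exact: uposC].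
Qed.

Lemma lower_wythoff_inj (R : realType) : injective (lower_wythoff R).
Proof.
move=> m n e; have := ltn_lower_wythoff R m n; have := ltn_lower_wythoff R n m.
rewrite e !ltnn; lia.
Qed.

Lemma upper_wythoff_inj (R : realType) :
  injective (fun n => lower_wythoff R n + n).
Proof.
move=> m n /= e.
have := ltn_lower_wythoff R m n; have := ltn_lower_wythoff R n m; lia.
Qed.

Lemma lower_wythoff_eq_upper (R : realType) (m n : nat) :
  lower_wythoff R n = lower_wythoff R m + m -> n = m.
Proof.
move=> e; have m0 := lower_wythoff_neq_upper e; apply: (@lower_wythoff_inj R).
by rewrite e m0 addn0.
Qed.

Lemma kernel_independent (R : realType) (c : nat) (p q : position) :
  0 < c -> move p q -> kernel R c p -> ~ kernel R c q.
Proof.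
move=> c0; case=> [a b k /andP[k0 ka]|a b k /andP[a0 ab] /andP[k0 ka] _].
  move=> [/upos_eq|[n /upos_eq]] hp [/upos_eq|[m /upos_eq]] hq; try lia.
  suff : n = m by move=> e; subst; lia.
  (* The untouched pile [b] may be the upper or the lower term in each of the two pairs. *)
  move: hp hq => [] [? ?] [] [? ?].
  - by apply: (@upper_wythoff_inj R); lia.
  - by apply/esym/(@lower_wythoff_eq_upper R); lia.
  - by apply: (@lower_wythoff_eq_upper R); lia.
  - by apply: (@lower_wythoff_inj R); lia.
move=> [/upos_eq|[n /upos_eq]] hp [/upos_eq|[m /upos_eq]] hq; try lia.
have e : n = m by lia.
subst; lia.
Qed.

Lemma kernel_absorbing (R : realType) (c : nat) (p : position) :
  0 < c <= 2 -> p != upos 0 0 ->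
  kernel R c p \/ exists2 q, move p q & kernel R c q.
Proof.
move=> hc; rewrite -(uposE p); case: p => -[a b] /= ab /eqP p0.
have {}p0 : 0 < b by case: b ab p0 => //; case: a.
have move_two k : 0 < k <= b -> move (upos a b) (upos a (b - k)).
  by move=> hk; rewrite uposC [upos a (b - k)]uposC; apply: move_one.
have [ac|ca] := ltnP a c.
  have [a0|a0] := posnP a.
    subst a; have [->|bc] := eqVneq b c.-1; first by left; left.
    right; exists (upos 0 c.-1); last by left.
    have -> : c.-1 = b - (b - c.-1) by lia.
    by apply: move_two; lia.
  (* Emptying the larger pile reaches [upos 0 1], the extra position for [c = 2]. *)
  have [a1 c2] : a = 1 /\ c = 2 by lia.
  right; exists (upos a (b - b)); first by apply: move_two; lia.
  by left; apply/upos_eq; lia.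
have [n [an|an]] := wythoff_cover R (a - c); last first.
  (* Here [a] is the larger entry of its pair, so the partner [x + c] is at most [a <= b]. *)
  set x := lower_wythoff R n in an.
  have [bx|bx] := eqVneq b (x + c).
    by left; right; exists n; apply/upos_eq; rewrite -/x; lia.
  right; exists (upos a (b - (b - (x + c)))); first by apply: move_two; lia.
  by right; exists n; apply/upos_eq; rewrite -/x; lia.
set x := lower_wythoff R n in an.
have [bx|bx|bx] := ltngtP b (x + n + c); last first.
- by left; right; exists n; apply/upos_eq; rewrite -/x; lia.
- right; exists (upos a (b - (b - (x + n + c)))); first by apply: move_two; lia.
  by right; exists n; apply/upos_eq; rewrite -/x; lia.
(* Both quotients below are [1], since the difference [m] is smaller than both
   of the smaller entries. *)
right; pose m := b - a; have mn : m < n by lia.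
have := ltn_lower_wythoff R m n; rewrite mn -/x => yx.
have xn := leq_lower_wythoff R n; rewrite -/x in xn.
(* With [0 < c] this gives [m < y + c], the smaller entry of the target pair of difference [m]. *)
have ym := leq_lower_wythoff R m.
set y := lower_wythoff R m in yx ym.
exists (upos (a - (x - y)) (b - (x - y))); last first.
  by right; exists m; apply/upos_eq; rewrite -/y; lia.
have div1 (u v : nat) : u <= v < u + u -> v %/ u = 1.
  move=> /andP[uv vu]; rewrite -(subnKC uv) divnDl // divnn divn_small; lia.
apply: move_both; try lia.
by rewrite !div1 //; lia.
Qed.

(** The difference of the entries fixes the index of a shifted pair, and the two shifts then
    disagree. *)
Lemma kernel12_disjoint (R : realType) (p : position) :
  kernel R 1 p -> ~ kernel R 2 p.
Proof.
move=> [->|[n ->]] [/upos_eq|[m /upos_eq]] h; try lia.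
have e : n = m by lia.
subst; lia.
Qed.

(** * Misère values 0 and 1 *)

Lemma mex_eq0 (s : seq nat) : (mex s == 0) = (0 \notin s).
Proof.
rewrite /mex; case: ex_minnP => -[|m] ms min_m; first by rewrite ms.
by apply/esym/negbTE/negP => /min_m.
Qed.

Lemma mex_eq1 (s : seq nat) : (mex s == 1) = (0 \in s) && (1 \notin s).
Proof.
rewrite /mex; case: ex_minnP => -[|[|m]] ms min_m.
- by rewrite (negPf ms).
- by rewrite ms andbT; apply/esym/negPn/negP => /min_m.
- apply/esym/negbTE/negP => /andP[_ /min_m]; lia.
Qed.

Lemma move_rank (p q : position) :
  move p q -> p != upos 0 0 /\ rank (Some q) < rank (Some p).
Proof.
move=> pq; have p0 : p != upos 0 0.
  by apply/eqP; case: pq => [a b k ?|a b k ? ? _] /upos_eq; lia.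
split=> //; apply: rank_misere_followers; rewrite /= (negPf p0).
by apply: map_f; apply/followersP.
Qed.

Lemma misere_followersP (p : position) (v : nat) :
  reflect (exists2 q, move p q & misere_grundy q = v)
          (v \in [seq misere_grundy q | q <- followers p]).
Proof.
apply: (iffP mapP) => -[q] pq.
  by move=> ->; exists q => //; apply/followersP.
by move=> <-; exists q => //; apply/followersP.
Qed.

Lemma misere_grundy_eq0 (R : realType) (p : position) :
  misere_grundy p = 0 <-> kernel R 2 p.
Proof.
have [r] := ubnP (rank (Some p)); elim: r p => // r IHr p pr.
have {}IHr q : move p q -> misere_grundy q = 0 <-> kernel R 2 q.
  by move=> /move_rank[_ qp]; apply: IHr; apply: leq_trans qp pr.
have [->|p0] := eqVneq p (upos 0 0).
  by rewrite misere_grundy_upos00; split=> // -[/upos_eq|[n /upos_eq]]; lia.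
rewrite misere_grundyE //; split=> [/eqP|Kp].
  rewrite mex_eq0 => /misere_followersP no0.
  have [//|[q pq Kq]] := @kernel_absorbing R 2 p isT p0.
  by case: no0; exists q => //; apply/IHr.
apply/eqP; rewrite mex_eq0; apply/misere_followersP => -[q pq /(IHr _ pq) Kq].
exact: (@kernel_independent R 2 _ _ isT pq).
Qed.

Lemma misere_grundy_eq1 (R : realType) (p : position) :
  misere_grundy p = 1 <-> kernel R 1 p.
Proof.
have [r] := ubnP (rank (Some p)); elim: r p => // r IHr p pr.
have {}IHr q : move p q -> misere_grundy q = 1 <-> kernel R 1 q.
  by move=> /move_rank[_ qp]; apply: IHr; apply: leq_trans qp pr.
have [->|p0] := eqVneq p (upos 0 0).
  by rewrite misere_grundy_upos00; split=> // _; left.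
rewrite misere_grundyE //; split=> [/eqP|Kp].
  rewrite mex_eq1 => /andP[_ /misere_followersP no1].
  have [//|[q pq Kq]] := @kernel_absorbing R 1 p isT p0.
  by case: no1; exists q => //; apply/IHr.
apply/eqP; rewrite mex_eq1; apply/andP; split.
  apply/misere_followersP.
  (* A follower of value 0 is needed for the mex to reach 1; since [p] avoids K_2, absorption into
     K_2 supplies it. *)
  have [/(kernel12_disjoint Kp) //|[q pq Kq]] := @kernel_absorbing R 2 p isT p0.
  by exists q => //; apply/(misere_grundy_eq0 R).
apply/misere_followersP => -[q pq /(IHr _ pq) Kq].
exact: (@kernel_independent R 1 _ _ isT pq).
Qed.

(** * Translation to the integer-indexed floor formulas *)

Lemma wythoff_shift_kernel (R : realType) (a b : nat) :
  a <= b -> wythoff_shift R (a, b) <-> kernel R 1 (upos a b).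
Proof.
move=> ab.
have floorA (n : nat) : Num.floor (phi R * n%:R)%R = Posz (lower_wythoff R n).
  apply: floor_def; rewrite intrD -pmulrn natr1; exact: lower_wythoff_itv.
have floorB (n : nat) :
    Num.floor (phi R ^+ 2 * n%:R)%R = Posz (lower_wythoff R n + n).
  (* Since [phi ^ 2 = phi + 1], the integer summand [n] comes out of the floor. *)
  by rewrite phi_sqr mulrDl mul1r floorDrz // floorA pmulrn intrKfloor.
split; last first.
  case=> [/upos_eq|[n /upos_eq]] h; [left|right]; first by congr pair; lia.
  by exists n; split=> //=; rewrite ?floorA ?floorB; lia.
case=> [[-> ->]|[[n|n] [//= _]]]; first by left.
by rewrite floorA floorB => *; right; exists n; apply/upos_eq; lia.
Qed.

Theorem theorem17 (R : realType) (a b : nat) (hab : a <= b) :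
  misere_grundy (upos a b) = 1 <-> wythoff_shift R (a, b).
Proof.
apply: (iff_trans (misere_grundy_eq1 R _)); apply: iff_sym.
exact: wythoff_shift_kernel.
Qed.
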